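(* Let $A$, $B$, $C$ be locally $C^*$-algebras, let $E$ be a Hilbert $B$-module, let $F$ be a Hilbert $C$-module, and let $\Phi_1:A\to L_B(E)$ and $\Phi_2:B\to L_C(F)$ be non-degenerate continuous $*$-morphisms. Put $G=E\otimes_{\Phi_2}F$ (the inner tensor product, a Hilbert $C$-module), on which $A$ acts through the non-degenerate continuous $*$-morphism $\Phi=(\Phi_2)_*\circ\Phi_1:A\to L_C(G)$. If $(\varphi,H)$ is a non-degenerate representation of $C$, then the representations $\left({}_G^A\varphi,\,{}_GH\right)$ (induced from $C$ to $A$ via $G$ and $\Phi$) and $\left({}_E^A({}_F^B\varphi),\,{}_E({}_FH)\right)$ (obtained by inducing $\varphi$ from $C$ to $B$ via $F$ and $\Phi_2$, and then inducing the result from $B$ to $A$ via $E$ and $\Phi_1$) of $A$ are unitarily equivalent.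
   Context: Locally $C^*$-algebras. A locally $C^*$-algebra is a complete Hausdorff complex topological $*$-algebra $A$ whose topology is determined by its continuous $C^*$-seminorms: a net $\{a_i\}$ converges to $0$ iff $\{p(a_i)\}$ converges to $0$ for every continuous $C^*$-seminorm $p$ on $A$. $S(A)$ denotes the set of all continuous $C^*$-seminorms on $A$. Representations. A representation $(\varphi,H)$ of $A$ is a continuous $*$-morphism $\varphi:A\to L(H)$, with $L(H)$ the $C^*$-algebra of bounded linear operators on a Hilbert space $H$. It is non-degenerate if $\varphi(A)H$ is dense in $H$. Two representations $(\varphi_1,H_1)$, $(\varphi_2,H_2)$ of $A$ are unitarily equivalent if there is a unitary operator $U$ from $H_1$ onto $H_2$ with $U\varphi_1(a)=\varphi_2(a)U$ for all $a\in A$. Hilbert modules. A pre-Hilbert $B$-module is a complex vector space $E$ which is a right $B$-module (compatibly with the complex algebra structure) with a $B$-valued inner product $\langle\cdot,\cdot\rangle:E\times E\to B$, $\mathbb{C}$- and $B$-linear in the second variable, such that $\langle\xi,\eta\rangle^*=\langle\eta,\xi\rangle$, $\langle\xi,\xi\rangle\ge 0$, and $\langle\xi,\xi\rangle=0$ iff $\xi=0$. It is a Hilbert $B$-module if it is complete for the topology given by the seminorms $\|\xi\|_q=\sqrt{q(\langle\xi,\xi\rangle)}$, $q\in S(B)$. $L_B(E)$ denotes the locally $C^*$-algebra of all adjointable linear operators on $E$, with topology given by the seminorms $\widetilde q(T)=\sup\{\|T\xi\|_q:\|\xi\|_q\le 1\}$, $q\in S(B)$. A continuous $*$-morphism $\Phi:A\to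 L_B(E)$ is non-degenerate if $\Phi(A)E$ is dense in $E$. Induced representation. Let $\Phi:A\to L_B(E)$ be a non-degenerate continuous $*$-morphism and $(\varphi,H)$ a non-degenerate representation of $B$. On $E\otimes_{\mathrm{alg}}H$ consider the positive semidefinite sesquilinear form determined by $\langle\xi\otimes h_1,\eta\otimes h_2\rangle_0^{\varphi}=\langle h_1,\varphi(\langle\xi,\eta\rangle_E)h_2\rangle$ (inner products are linear in the second variable). ${}_EH$ is the Hilbert space completion of the quotient of $E\otimes_{\mathrm{alg}}H$ by the subspace of vectors of zero length for this form. For $T\in L_B(E)$, the map $\xi\otimes h\mapsto T\xi\otimes h$ induces a bounded operator ${}_E\varphi(T)$ on ${}_EH$, and ${}_E\varphi$ is a non-degenerate representation of $L_B(E)$ on ${}_EH$. The (Rieffel-)induced representation from $B$ to $A$ via $E$ is the non-degenerate representation $({}_E^A\varphi,{}_EH)$ of $A$, where ${}_E^A\varphi={}_E\varphi\circ\Phi$. Inner tensor product. For a Hilbert $B$-module $E$, a Hilbert $C$-module $F$ and a non-degenerate continuous $*$-morphism $\Phi_2:B\to L_C(F)$, $E\otimes_{\Phi_2}F$ is the Hilbert $C$-module obtained from $E\otimes_{\mathrm{alg}}F$, with right $C$-action $(\xi\otimes\eta)c=\xi\otimes\eta c$ and $C$-valued form $\langle\xi\otimes\eta,\xi'\otimes\eta'\rangle=\langle\eta,\Phi_2(\langle\xi,\xi'\rangle_E)\eta'\rangle_F$, by quotienting by the subspace of vectors of zero length and completing; the image of $\xi\otimes\eta$ is written $\xi\otimes_{\Phi_2}\eta$.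 The non-degenerate continuous $*$-morphism $(\Phi_2)_*:L_B(E)\to L_C(E\otimes_{\Phi_2}F)$ is given by $(\Phi_2)_*(T)(\xi\otimes_{\Phi_2}\eta)=T\xi\otimes_{\Phi_2}\eta$. *)

(* Defs.v *)
From HB Require Import structures.
From mathcomp Require Import all_boot all_order all_algebra generic_quotient.
From mathcomp Require Import complex.
From mathcomp Require Import all_classical all_reals all_analysis.

Set Implicit Arguments.
Unset Strict Implicit.
Unset Printing Implicit Defensive.

Import Order.TTheory GRing.Theory Num.Theory.
Import numFieldNormedType.Exports.

Local Open Scope classical_set_scope.
Local Open Scope quotient_scope.
Local Open Scope ring_scope.
Local Open Scope complex_scope.

(* The complex field is R[i] for an arbitrary model R of the real numbers.
   All inner products are linear in the second variable. *)

(* V (x)_alg W is the type of finite formal sums of pairs modulo the smallest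
   congruence that makes the pairs bilinear. *)
Section TensorProduct.
Variables (K : comNzRingType) (V W : lmodType K).

Inductive tens_rel : seq (V * W) -> seq (V * W) -> Prop :=
| tens_refl s : tens_rel s s
| tens_sym s t : tens_rel s t -> tens_rel t s
| tens_trans s t u : tens_rel s t -> tens_rel t u -> tens_rel s u
| tens_comm s t : tens_rel (s ++ t) (t ++ s)
| tens_cat u s t : tens_rel s t -> tens_rel (u ++ s) (u ++ t)
| tens_zero y : tens_rel [:: (0, y)] [::]
| tens_addl x x' y : tens_rel [:: (x + x', y)] [:: (x, y); (x', y)]
| tens_addr x y y' : tens_rel [:: (x, y + y')] [:: (x, y); (x, y')]
| tens_scale a x y : tens_rel [:: (a *: x, y)] [:: (x, a *: y)].

Definition tens_eq (s t : seq (V * W)) : bool := `[< tens_rel s t >].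

Lemma tens_eq_refl : reflexive tens_eq.
Proof. by move=> s; apply/asboolP; exact: tens_refl. Qed.

Lemma tens_eq_sym : symmetric tens_eq.
Proof. by move=> s t; apply/asboolP/asboolP; exact: tens_sym. Qed.

Lemma tens_eq_trans : transitive tens_eq.
Proof.
by move=> t s u /asboolP st /asboolP tu; apply/asboolP; exact: tens_trans tu.
Qed.

Canonical tens_equiv :=
  EquivRel tens_eq tens_eq_refl tens_eq_sym tens_eq_trans.

Definition tensor := {eq_quot tens_eq}.

HB.instance Definition _ := Choice.on tensor.
HB.instance Definition _ := EqQuotient.on tensor.

Implicit Types s t : seq (V * W).

Lemma tens_pi s t : tens_rel s t <-> \pi_tensor s = \pi_tensor t.
Proof.
split; first by move=> st; apply/eqmodP/asboolP.
by move=> /eqmodP/asboolP.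
Qed.

Lemma tens_catD s s' t t' :
  tens_rel s s' -> tens_rel t t' -> tens_rel (s ++ t) (s' ++ t').
Proof.
move=> ss' tt'; apply: tens_trans (tens_cat s tt') _.
apply: tens_trans (tens_comm _ _) _.
by apply: tens_trans (tens_cat t' ss') _; exact: tens_comm.
Qed.

Lemma tens_repr s : tens_rel (repr (\pi_tensor s)) s.
Proof. by apply/tens_pi; rewrite reprK. Qed.

Definition seq_scale (a : K) s := [seq (a *: p.1, p.2) | p <- s].

Lemma seq_scale_rel a s t :
  tens_rel s t -> tens_rel (seq_scale a s) (seq_scale a t).
Proof.
elim=> /= {s t}.
- by move=> s; exact: tens_refl.
- by move=> s t _; exact: tens_sym.
- by move=> s t u _ st _; exact: tens_trans st.
- by move=> s t; rewrite /seq_scale !map_cat; exact: tens_comm.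
- by move=> u s t _ st; rewrite /seq_scale !map_cat; exact: tens_cat.
- by move=> y; rewrite scaler0; exact: tens_zero.
- by move=> x x' y; rewrite scalerDr; exact: tens_addl.
- by move=> x y y'; exact: tens_addr.
- by move=> b x y; rewrite scalerA mulrC -scalerA; exact: tens_scale.
Qed.

Definition tadd (u v : tensor) : tensor := \pi_tensor (repr u ++ repr v).
Definition tzero : tensor := \pi_tensor [::].
Definition tscale (a : K) (u : tensor) : tensor :=
  \pi_tensor (seq_scale a (repr u)).
Definition topp (u : tensor) : tensor := tscale (-1) u.

Lemma tadd_pi s t : tadd (\pi_tensor s) (\pi_tensor t) = \pi_tensor (s ++ t).
Proof. by apply/tens_pi; apply: tens_catD; exact: tens_repr. Qed.

Lemma tscale_pi a s : tscale a (\pi_tensor s) = \pi_tensor (seq_scale a s).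
Proof. by apply/tens_pi/seq_scale_rel/tens_repr. Qed.

Lemma tens_ind (P : tensor -> Prop) :
  (forall s, P (\pi_tensor s)) -> forall u, P u.
Proof. by move=> Ps u; rewrite -[u]reprK. Qed.

Lemma taddA : associative tadd.
Proof.
elim/tens_ind=> s; elim/tens_ind=> t; elim/tens_ind=> u.
by rewrite !tadd_pi catA.
Qed.

Lemma taddC : commutative tadd.
Proof.
elim/tens_ind=> s; elim/tens_ind=> t; rewrite !tadd_pi.
by apply/tens_pi; exact: tens_comm.
Qed.

Lemma tadd0 : left_id tzero tadd.
Proof. by elim/tens_ind=> s; rewrite tadd_pi. Qed.

Lemma seq_scaleDl a b s :
  tens_rel (seq_scale (a + b) s) (seq_scale a s ++ seq_scale b s).
Proof.
elim: s => [|[x y] s IH] /=; first exact: tens_refl.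
rewrite scalerDl.
apply: tens_trans (tens_catD (tens_addl (a *: x) (b *: x) y) IH) _ => /=.
apply: (tens_cat [:: (a *: x, y)]).
rewrite -[X in tens_rel X](catA [:: (b *: x, y)]) -[X in tens_rel _ X]cat_rcons.
rewrite catA -cats1.
by apply: tens_catD; [exact: tens_comm|exact: tens_refl].
Qed.

Lemma tscaleDl v : {morph tscale^~ v : a b / a + b >-> tadd a b}.
Proof.
by move=> a b; elim/tens_ind: v => s; rewrite !tscale_pi tadd_pi;
  apply/tens_pi/seq_scaleDl.
Qed.

Lemma tscale0 u : tscale 0 u = tzero.
Proof.
elim/tens_ind: u => s; rewrite tscale_pi; apply/tens_pi.
elim: s => [|[x y] s IH] /=; first exact: tens_refl.
by rewrite scale0r; exact: (tens_catD (tens_zero y) IH).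
Qed.

Lemma tscale1 : left_id 1 tscale.
Proof.
elim/tens_ind=> s; rewrite tscale_pi; congr (\pi_tensor _).
by rewrite /seq_scale -[RHS]map_id; apply: eq_map => -[x y]; rewrite scale1r.
Qed.

Lemma taddN : left_inverse tzero topp tadd.
Proof.
by move=> u; rewrite /topp -{2}[u]tscale1 -tscaleDl addNr tscale0.
Qed.

HB.instance Definition _ := GRing.isZmodule.Build tensor taddA taddC tadd0 taddN.

Lemma tscaleA a b v : tscale a (tscale b v) = tscale (a * b) v.
Proof.
elim/tens_ind: v => s; rewrite !tscale_pi /seq_scale -map_comp.
by congr (\pi_tensor _); apply: eq_map => -[x y] /=; rewrite scalerA.
Qed.

Lemma tscaleDr : right_distributive tscale +%R.
Proof.
move=> a; elim/tens_ind=> s; elim/tens_ind=> t.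
rewrite -[_ + _]/(tadd _ _) -[X in _ = X]/(tadd _ _).
by rewrite tadd_pi !tscale_pi tadd_pi /seq_scale map_cat.
Qed.

HB.instance Definition _ := GRing.Zmodule_isLmodule.Build K tensor
  tscaleA tscale1 tscaleDr tscaleDl.

Definition tens (x : V) (y : W) : tensor := \pi_tensor [:: (x, y)].

Lemma tensDl x x' y : tens (x + x') y = tens x y + tens x' y.
Proof.
by rewrite -[RHS]/(tadd _ _) tadd_pi; apply/tens_pi; exact: tens_addl.
Qed.

Lemma tensDr x y y' : tens x (y + y') = tens x y + tens x y'.
Proof.
by rewrite -[RHS]/(tadd _ _) tadd_pi; apply/tens_pi; exact: tens_addr.
Qed.

Lemma tensZl a x y : tens (a *: x) y = a *: tens x y.
Proof. by rewrite -[RHS]/(tscale _ _) tscale_pi. Qed.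

Lemma tensZr a x y : tens x (a *: y) = a *: tens x y.
Proof. by rewrite -tensZl; apply/tens_pi/tens_sym; exact: tens_scale. Qed.

End TensorProduct.

Notation "x \ox y" := (tens x y) (at level 40, left associativity).

Section TensorForm.
Variables (K : comNzRingType) (V W : lmodType K) (X : zmodType).
Implicit Types f : V -> W -> X.

Definition balanced f :=
  [/\ forall x x' y, f (x + x') y = f x y + f x' y,
      forall x y y', f x (y + y') = f x y + f x y' &
      forall a x y, f (a *: x) y = f x (a *: y)].

Lemma tens_sum f s t : balanced f -> tens_rel s t ->
  \sum_(p <- s) f p.1 p.2 = \sum_(p <- t) f p.1 p.2.
Proof.
move=> [fl fr fZ]; elim=> {s t} //.
- by move=> s t u _ -> _ ->.
- by move=> s t; rewrite !big_cat /= addrC.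
- by move=> u s t _ st; rewrite !big_cat /= st.
- move=> y; rewrite big_seq1 big_nil /=.
  by apply: (addrI (f 0 y)); rewrite -fl !addr0.
- by move=> x x' y; rewrite !big_cons !big_nil /= !addr0 fl.
- by move=> x y y'; rewrite !big_cons !big_nil /= !addr0 fr.
- by move=> a x y; rewrite !big_seq1 /= fZ.
Qed.

(* The extension to V (x)_alg W of a form given on pure tensors by
   g x y x' y' = <x (x) y, x' (x) y'>, biadditive and balanced in (x, y) and in
   (x', y'); tens_formE shows that it does not depend on the representatives. *)
Definition tens_form (g : V -> W -> V -> W -> X) (u v : tensor V W) : X :=
  \sum_(p <- repr u) \sum_(r <- repr v) g p.1 p.2 r.1 r.2.

Definition form_balanced (g : V -> W -> V -> W -> X) :=
  (forall x y, balanced (g x y)) /\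
  (forall x' y', balanced (fun x y => g x y x' y')).

Lemma tens_formE g s t : form_balanced g ->
  tens_form g (\pi_(tensor V W) s) (\pi_(tensor V W) t) =
  \sum_(p <- s) \sum_(r <- t) g p.1 p.2 r.1 r.2.
Proof.
move=> [g2 g1]; rewrite /tens_form.
rewrite (eq_bigr (fun p => \sum_(r <- t) g p.1 p.2 r.1 r.2)); last first.
  by move=> p _; exact/tens_sum/tens_repr.
rewrite exchange_big [RHS]exchange_big /=; apply: eq_bigr => r _.
exact: (tens_sum (g1 _ _) (tens_repr _)).
Qed.

Lemma tens_form_tens g x y x' y' : form_balanced g ->
  tens_form g (x \ox y) (x' \ox y') = g x y x' y'.
Proof. by move=> gb; rewrite tens_formE// !big_seq1. Qed.

End TensorForm.

(* Complex *-algebras, not necessarily unital. *)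
HB.mixin Record Lmodule_isStarAlgebra (R : realType) A & GRing.Lmodule R[i] A := {
  smul : A -> A -> A ;
  star : A -> A ;
  smulA : associative smul ;
  smulDl : forall a b c, smul (a + b) c = smul a c + smul b c ;
  smulDr : forall a b c, smul a (b + c) = smul a b + smul a c ;
  smulZl : forall (k : R[i]) a b, smul (k *: a) b = k *: smul a b ;
  smulZr : forall (k : R[i]) a b, smul a (k *: b) = k *: smul a b ;
  starD : forall a b, star (a + b) = star a + star b ;
  starZ : forall (k : R[i]) a, star (k *: a) = k^* *: star a ;
  starM : forall a b, star (smul a b) = smul (star b) (star a) ;
  starK : involutive star
}.

#[short(type="starAlgType")]
HB.structure Definition StarAlgebra (R : realType) :=
  {A of GRing.Lmodule R[i] A & Lmodule_isStarAlgebra R A}.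

(* As for preTopologicalLmodType, no compatibility between the algebraic
   structure and the topology is required here. *)
#[short(type="preTopStarAlgType")]
HB.structure Definition PreTopStarAlgebra (R : realType) :=
  {A of StarAlgebra R A & Topological A}.

(* Completeness for the uniform structure of the additive group. The cauchy
   filters of a tvsType are not used because its uniform structure is only
   required to induce the topology, not to be translation invariant. *)
Definition tvs_cauchy (V : topologicalZmodType) (F : set_system V) :=
  forall U, nbhs (0 : V) U ->
    exists2 X, F X & forall x y, X x -> X y -> U (x - y).

Definition tvs_complete (V : topologicalZmodType) :=
  forall F : set_system V, ProperFilter F -> tvs_cauchy F ->
    exists x : V, F --> x.

Section CstarSeminorm.
Variables (R : realType) (A : preTopStarAlgType R).

Record Cstar_seminorm (p : A -> R) : Prop := {
  Cstar_ge0 : forall a, 0 <= p a ;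
  Cstar_triangle : forall a b, p (a + b) <= p a + p b ;
  Cstar_scale : forall (k : R[i]) a, p (k *: a) = complex.Re `|k| * p a ;
  Cstar_mul : forall a b, p (smul a b) <= p a * p b ;
  Cstar_star : forall a, p (star a) = p a ;
  Cstar_id : forall a, p (smul (star a) a) = p a ^+ 2
}.

Definition SC : set (A -> R) := [set p | Cstar_seminorm p /\ continuous p].

Definition positive (a : A) := exists b, a = smul (star b) b.

End CstarSeminorm.
Arguments SC {R} A.

(* In lCstar_seminorm_cvg filters play the role of nets. *)
HB.mixin Record isLocallyCstar (R : realType) A
    & StarAlgebra R A & TopologicalLmodule R[i] A := {
  smul_continuous : continuous (fun z : A * A => smul z.1 z.2) ;
  star_continuous : continuous (star : A -> A) ;
  lCstar_hausdorff : hausdorff_space A ;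
  lCstar_complete : tvs_complete A ;
  lCstar_seminorm_cvg : forall F : set_system A, Filter F ->
    F --> (0 : A) <-> forall p : A -> R, SC A p -> p @ F --> (0 : R)
}.

#[short(type="locallyCstarType")]
HB.structure Definition LocallyCstar (R : realType) :=
  {A of StarAlgebra R A & TopologicalLmodule R[i] A & isLocallyCstar R A}.

Record star_hom (R : realType) (A B : preTopStarAlgType R) := StarHom {
  star_hom_fun :> A -> B ;
  star_hom_linear : linear star_hom_fun ;
  star_homM : forall a b,
    star_hom_fun (smul a b) = smul (star_hom_fun a) (star_hom_fun b) ;
  star_hom_star : forall a, star_hom_fun (star a) = star (star_hom_fun a) ;
  star_hom_continuous : continuous star_hom_fun
}.

Section StarHomComp.
Variables (R : realType) (A B C : preTopStarAlgType R).
Variables (g : star_hom B C) (f : star_hom A B).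

Lemma star_comp_linear : linear (g \o f).
Proof. by move=> k a b /=; rewrite !star_hom_linear. Qed.

Lemma star_compM a b : (g \o f) (smul a b) = smul ((g \o f) a) ((g \o f) b).
Proof. by rewrite /= !star_homM. Qed.

Lemma star_comp_star a : (g \o f) (star a) = star ((g \o f) a).
Proof. by rewrite /= !star_hom_star. Qed.

Lemma star_comp_continuous : continuous (g \o f).
Proof.
by move=> a; apply: continuous_comp; exact: star_hom_continuous.
Qed.

Definition star_comp : star_hom A C :=
  StarHom star_comp_linear star_compM star_comp_star star_comp_continuous.

End StarHomComp.

HB.mixin Record isHilbertModule (R : realType) (B : locallyCstarType R) E
    & TopologicalLmodule R[i] E := {
  ract : E -> B -> E ;
  hminner : E -> E -> B ;
  ractDl : forall x y b, ract (x + y) b = ract x b + ract y b ;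
  ractDr : forall x b c, ract x (b + c) = ract x b + ract x c ;
  ractM : forall x b c, ract x (smul b c) = ract (ract x b) c ;
  ractZl : forall (k : R[i]) x b, ract (k *: x) b = k *: ract x b ;
  ractZr : forall (k : R[i]) x b, ract x (k *: b) = k *: ract x b ;
  hminnerDr : forall x y z, hminner x (y + z) = hminner x y + hminner x z ;
  hminnerZr : forall (k : R[i]) x y, hminner x (k *: y) = k *: hminner x y ;
  hminner_ract : forall x y b, hminner x (ract y b) = smul (hminner x y) b ;
  hminner_star : forall x y, star (hminner x y) = hminner y x ;
  hminner_ge0 : forall x, positive (hminner x x) ;
  hminner_eq0 : forall x, hminner x x = 0 <-> x = 0 ;
  hm_seminorm_cvg : forall F : set_system E, Filter F ->
    F --> (0 : E) <-> forall q : B -> R, SC B q ->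
      (fun x => Num.sqrt (q (hminner x x))) @ F --> (0 : R) ;
  hm_complete : tvs_complete E
}.

#[short(type="hilbertModuleType")]
HB.structure Definition HilbertModule (R : realType) (B : locallyCstarType R) :=
  {E of TopologicalLmodule R[i] E & isHilbertModule R B E}.

Section Adjointable.
Variables (R : realType) (B : locallyCstarType R) (E : hilbertModuleType B).
Implicit Types (x y z : E) (k : R[i]).

Definition hm_norm (q : B -> R) x : R := Num.sqrt (q (hminner x x)).

Definition adjoint_to (T S : E -> E) :=
  forall x y, hminner (T x) y = hminner x (S y).

Lemma hminnerDl x y z : hminner (x + y) z = hminner x z + hminner y z.
Proof. by rewrite -hminner_star hminnerDr starD !hminner_star. Qed.

Lemma hminnerZl k x y : hminner (k *: x) y = k^* *: hminner x y.
Proof. by rewrite -hminner_star hminnerZr starZ hminner_star. Qed.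

Lemma hminner_injr x y : (forall z, hminner z x = hminner z y) -> x = y.
Proof.
move=> xy; apply/eqP; rewrite -subr_eq0; apply/eqP/hminner_eq0.
by rewrite hminnerDr -scaleN1r hminnerZr xy !scaleN1r subrr.
Qed.

Lemma adjoint_toC T S : adjoint_to T S -> adjoint_to S T.
Proof. by move=> TS x y; rewrite -hminner_star -TS hminner_star. Qed.

Lemma adjoint_to_linear T S : adjoint_to T S -> linear T.
Proof.
move=> /adjoint_toC TS k x y; apply: hminner_injr => z.
by rewrite hminnerDr hminnerZr -!TS hminnerDr hminnerZr.
Qed.

Lemma adjoint_to_uniq T S S' : adjoint_to T S -> adjoint_to T S' -> S = S'.
Proof.
by move=> TS TS'; apply/funext => y; apply: hminner_injr => x; rewrite -TS TS'.
Qed.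

(* The adjointable operators; their linearity is a consequence
   (adjoint_to_linear). *)
Record adjointable := Adjointable {
  adj_fun :> E -> E ;
  adj_ex : exists S, adjoint_to adj_fun S
}.

Implicit Types S T : adjointable.

Lemma adj_eqP S T : S =1 T -> S = T.
Proof.
case: S T => [S hS] [T hT] /= /funext ST.
by case: _ / ST hT => hT; congr Adjointable; exact: Prop_irrelevance.
Qed.

HB.instance Definition _ := gen_eqMixin adjointable.
HB.instance Definition _ := gen_choiceMixin adjointable.

Lemma adj_linear T : linear T.
Proof. by have [S /adjoint_to_linear] := adj_ex T. Qed.

Definition adj_star_fun T : E -> E := projT1 (cid (adj_ex T)).

Lemma adj_star_funP T : adjoint_to T (adj_star_fun T).
Proof. exact: (projT2 (cid (adj_ex T))). Qed.

Definition adj_star T : adjointable :=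
  Adjointable (ex_intro _ _ (adjoint_toC (adj_star_funP T))).

Lemma adj_star_eq T S : adjoint_to T S -> adj_star T = S.
Proof.
by move=> TS; apply: adj_eqP => x; rewrite (adjoint_to_uniq TS (adj_star_funP T)).
Qed.

Lemma adj_zero_subproof : adjoint_to (fun=> 0) (fun=> 0).
Proof.
move=> x y; have -> : hminner x 0 = 0.
  by apply: (addrI (hminner x 0)); rewrite -hminnerDr !addr0.
by apply: (addrI (hminner 0 y)); rewrite -hminnerDl !addr0.
Qed.

Lemma adj_add_subproof S T :
  adjoint_to (fun x => S x + T x) (fun x => adj_star S x + adj_star T x).
Proof. by move=> x y; rewrite hminnerDl hminnerDr !adj_star_funP. Qed.

Lemma adj_scale_subproof k T :
  adjoint_to (fun x => k *: T x) (fun x => k^* *: adj_star T x).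
Proof. by move=> x y; rewrite hminnerZl hminnerZr adj_star_funP. Qed.

Lemma adj_mul_subproof S T :
  adjoint_to (fun x => S (T x)) (fun x => adj_star T (adj_star S x)).
Proof. by move=> x y; rewrite !adj_star_funP. Qed.

Definition adj_zero := Adjointable (ex_intro _ _ adj_zero_subproof).
Definition adj_add S T := Adjointable (ex_intro _ _ (adj_add_subproof S T)).
Definition adj_scale k T := Adjointable (ex_intro _ _ (adj_scale_subproof k T)).
Definition adj_opp T := adj_scale (-1) T.
Definition adj_mul S T := Adjointable (ex_intro _ _ (adj_mul_subproof S T)).

Lemma adj_addA : associative adj_add.
Proof. by move=> S T U; apply: adj_eqP => x /=; rewrite addrA. Qed.

Lemma adj_addC : commutative adj_add.
Proof. by move=> S T; apply: adj_eqP => x /=; rewrite addrC. Qed.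

Lemma adj_add0 : left_id adj_zero adj_add.
Proof. by move=> S; apply: adj_eqP => x /=; rewrite add0r. Qed.

Lemma adj_addN : left_inverse adj_zero adj_opp adj_add.
Proof. by move=> S; apply: adj_eqP => x /=; rewrite scaleN1r addNr. Qed.

HB.instance Definition _ := GRing.isZmodule.Build adjointable
  adj_addA adj_addC adj_add0 adj_addN.

Lemma adj_scaleA k l T : adj_scale k (adj_scale l T) = adj_scale (k * l) T.
Proof. by apply: adj_eqP => x /=; rewrite scalerA. Qed.

Lemma adj_scale1 : left_id 1 adj_scale.
Proof. by move=> T; apply: adj_eqP => x /=; rewrite scale1r. Qed.

Lemma adj_scaleDr : right_distributive adj_scale +%R.
Proof. by move=> k S T; apply: adj_eqP => x /=; rewrite scalerDr. Qed.

Lemma adj_scaleDl T : {morph adj_scale^~ T : k l / k + l}.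
Proof. by move=> k l; apply: adj_eqP => x /=; rewrite scalerDl. Qed.

HB.instance Definition _ := GRing.Zmodule_isLmodule.Build R[i] adjointable
  adj_scaleA adj_scale1 adj_scaleDr adj_scaleDl.

Lemma adj_mulA : associative adj_mul.
Proof. by move=> S T U; exact: adj_eqP. Qed.

Lemma adj_mulDl S T U : adj_mul (S + T) U = adj_mul S U + adj_mul T U.
Proof. exact: adj_eqP. Qed.

Lemma adj_funD T x y : T (x + y) = T x + T y.
Proof. by rewrite -[x]scale1r adj_linear !scale1r. Qed.

Lemma adj_fun0 T : T 0 = 0.
Proof. by apply: (addrI (T 0)); rewrite -adj_funD !addr0. Qed.

Lemma adj_funZ T k x : T (k *: x) = k *: T x.
Proof. by rewrite -[k *: x]addr0 adj_linear adj_fun0 addr0. Qed.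

Lemma adj_mulDr S T U : adj_mul S (T + U) = adj_mul S T + adj_mul S U.
Proof. by apply: adj_eqP => x; rewrite /= adj_funD. Qed.

Lemma adj_mulZl k S T : adj_mul (k *: S) T = k *: adj_mul S T.
Proof. exact: adj_eqP. Qed.

Lemma adj_mulZr k S T : adj_mul S (k *: T) = k *: adj_mul S T.
Proof. by apply: adj_eqP => x; rewrite /= adj_funZ. Qed.

Lemma adj_starD S T : adj_star (S + T) = adj_star S + adj_star T.
Proof. by apply: adj_star_eq; exact: adj_add_subproof. Qed.

Lemma adj_starZ k T : adj_star (k *: T) = k^* *: adj_star T.
Proof. by apply: adj_star_eq; exact: adj_scale_subproof. Qed.

Lemma adj_starM S T :
  adj_star (adj_mul S T) = adj_mul (adj_star T) (adj_star S).
Proof. by apply: adj_star_eq; exact: adj_mul_subproof. Qed.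

Lemma adj_starK : involutive adj_star.
Proof. by move=> T; apply: adj_star_eq; exact/adjoint_toC/adj_star_funP. Qed.

HB.instance Definition _ := Lmodule_isStarAlgebra.Build R adjointable
  adj_mulA adj_mulDl adj_mulDr adj_mulZl adj_mulZr
  adj_starD adj_starZ adj_starM adj_starK.

(* The supremum is taken in the extended reals, so that it has no junk value. *)
Definition op_seminorm (q : B -> R) T : \bar R :=
  ereal_sup [set (hm_norm q (T x))%:E | x in [set x | hm_norm q x <= 1]].

HB.instance Definition _ := isPointed.Build adjointable 0.

(* The topology generated by the open balls of the seminorms op_seminorm q. *)
HB.instance Definition _ := isSubBaseTopological.Build adjointable
  [set i : (B -> R) * adjointable * R | SC B i.1.1]
  (fun i => [set T | (op_seminorm i.1.1 (T - i.1.2)%R < (i.2)%:E)%E]).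

End Adjointable.

(* Phi : A -> L_B(E) is non-degenerate if the linear span of Phi(A)E is dense
   (the sums of elements of Phi(A)E form this span, Phi being linear). *)
Definition nondegenerate_hom (R : realType) (A : preTopStarAlgType R)
    (B : locallyCstarType R) (E : hilbertModuleType B)
    (Phi : star_hom A (adjointable E)) :=
  dense [set x : E | exists s : seq (A * E),
    x = \sum_(p <- s) Phi p.1 p.2].

HB.mixin Record isHilbert (R : realType) H & CompleteNormedModule R[i] H := {
  hinner : H -> H -> R[i] ;
  hinnerDr : forall x y z, hinner x (y + z) = hinner x y + hinner x z ;
  hinnerZr : forall (k : R[i]) x y, hinner x (k *: y) = k * hinner x y ;
  hinner_conj : forall x y, (hinner x y)^* = hinner y x ;
  hinner_norm : forall x, hinner x x = `|x| ^+ 2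
}.

#[short(type="hilbertType")]
HB.structure Definition Hilbert (R : realType) :=
  {H of CompleteNormedModule R[i] H & isHilbert R H}.

Section BoundedOp.
Variables (R : realType) (H : hilbertType R).

Record bounded_op := BoundedOp {
  bop_fun :> {linear H -> H} ;
  bop_bounded : exists M : R[i], forall x, `|bop_fun x| <= M * `|x|
}.

HB.instance Definition _ := gen_eqMixin bounded_op.
HB.instance Definition _ := gen_choiceMixin bounded_op.

Lemma bop_zero_subproof :
  exists M : R[i], forall x, `|(\0 : {linear H -> H}) x| <= M * `|x|.
Proof. by exists 0 => x; rewrite normr0 mul0r. Qed.

HB.instance Definition _ :=
  isPointed.Build bounded_op (BoundedOp bop_zero_subproof).

(* The operator norm of S - T. *)
Definition op_dist (S T : bounded_op) : R :=
  sup [set complex.Re `|S x - T x| | x in [set x | `|x| <= 1]].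

HB.instance Definition _ := isSubBaseTopological.Build bounded_op
  [set: bounded_op * R] (fun i => [set T | op_dist T i.1 < i.2]).

End BoundedOp.

Record representation (R : realType) (A : preTopStarAlgType R)
    (H : hilbertType R) := Representation {
  rep_fun :> A -> bounded_op H ;
  repD : forall a b h, rep_fun (a + b) h = rep_fun a h + rep_fun b h ;
  repZ : forall (k : R[i]) a h, rep_fun (k *: a) h = k *: rep_fun a h ;
  repM : forall a b h, rep_fun (smul a b) h = rep_fun a (rep_fun b h) ;
  rep_star : forall a h h',
    hinner (rep_fun (star a) h) h' = hinner h (rep_fun a h') ;
  rep_continuous : continuous rep_fun
}.

Definition nondegenerate_rep (R : realType) (A : preTopStarAlgType R)
    (H : hilbertType R) (phi : representation A H) :=
  dense [set x : H | exists s : seq (A * H), x = \sum_(p <- s) phi p.1 p.2].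

Definition unitarily_equivalent (R : realType) (A : preTopStarAlgType R)
    (H1 H2 : hilbertType R)
    (phi1 : representation A H1) (phi2 : representation A H2) :=
  exists U : {linear H1 -> H2},
    [/\ forall x y, hinner (U x) (U y) = hinner x y,
        forall y, exists x, U x = y &
        forall a x, U (phi1 a x) = phi2 a (U x)].

Section RepComp.
Variables (R : realType) (A B : preTopStarAlgType R) (H : hilbertType R).
Variables (phi : representation B H) (Phi : star_hom A B).

Lemma star_homD a b : Phi (a + b) = Phi a + Phi b.
Proof. by rewrite -[a]scale1r star_hom_linear !scale1r. Qed.

Lemma star_homZ k a : Phi (k *: a) = k *: Phi a.
Proof.
have Phi0 : Phi 0 = 0 by apply: (addrI (Phi 0)); rewrite -star_homD !addr0.
by rewrite -[k *: a]addr0 star_hom_linear Phi0 addr0.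
Qed.

Lemma rep_compD a b h : phi (Phi (a + b)) h = phi (Phi a) h + phi (Phi b) h.
Proof. by rewrite star_homD repD. Qed.

Lemma rep_compZ (k : R[i]) a h : phi (Phi (k *: a)) h = k *: phi (Phi a) h.
Proof. by rewrite star_homZ repZ. Qed.

Lemma rep_compM a b h :
  phi (Phi (smul a b)) h = phi (Phi a) (phi (Phi b) h).
Proof. by rewrite star_homM repM. Qed.

Lemma rep_comp_star a h h' :
  hinner (phi (Phi (star a)) h) h' = hinner h (phi (Phi a) h').
Proof. by rewrite star_hom_star rep_star. Qed.

Lemma rep_comp_continuous : continuous (fun a => phi (Phi a)).
Proof.
move=> a; apply: (@continuous_comp _ _ _ Phi phi).
  exact: star_hom_continuous.
exact: rep_continuous.
Qed.

Definition rep_comp : representation A H :=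
  Representation rep_compD rep_compZ rep_compM rep_comp_star
    rep_comp_continuous.

End RepComp.

Section Induced.
Variables (R : realType) (B : locallyCstarType R) (E : hilbertModuleType B).
Variables (H : hilbertType R) (phi : representation B H).

Definition ind_form : tensor E H -> tensor E H -> R[i] :=
  tens_form (fun x h y h' => hinner h (phi (hminner x y) h')).

Lemma hinnerDl (x y z : H) : hinner (x + y) z = hinner x z + hinner y z.
Proof. by rewrite -hinner_conj hinnerDr rmorphD /= !hinner_conj. Qed.

Lemma hinnerZl (k : R[i]) (x y : H) : hinner (k *: x) y = k^* * hinner x y.
Proof. by rewrite -hinner_conj hinnerZr rmorphM /= hinner_conj. Qed.

Lemma ind_form_balanced :
  form_balanced (fun (x : E) (h : H) (y : E) (h' : H) =>
    hinner h (phi (hminner x y) h')).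
Proof.
split=> x h; split=> [y y' g|y g g'|k y g].
- by rewrite hminnerDr repD hinnerDr.
- by rewrite linearD hinnerDr.
- by rewrite hminnerZr repZ linearZ.
- by rewrite hminnerDl repD hinnerDr.
- by rewrite hinnerDl.
- by rewrite hminnerZl repZ hinnerZr hinnerZl.
Qed.

Lemma ind_form_tens (x y : E) (h h' : H) :
  ind_form (x \ox h) (y \ox h') = hinner h (phi (hminner x y) h').
Proof. exact: tens_form_tens ind_form_balanced. Qed.

(* A Hilbert space completion of E (x)_alg H modulo the vectors of zero length:
   by ind_inner the kernel of ind_map is the subspace of these vectors, and
   ind_map induces an inner product preserving map on the quotient; with
   ind_dense and the completeness of ind_space this is the definition of a
   completion, unique up to a unitary operator. The operators ind_op T are those
   induced by x (x) h |-> T x (x) h; they exist for every completion, and they are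
   unique by density. *)
Record induction := Induction {
  ind_space : hilbertType R ;
  ind_map : {linear tensor E H -> ind_space} ;
  ind_inner : forall u v, hinner (ind_map u) (ind_map v) = ind_form u v ;
  ind_dense : dense (range ind_map) ;
  ind_op : representation (adjointable E) ind_space ;
  ind_opE : forall T x h, ind_op T (ind_map (x \ox h)) = ind_map (T x \ox h)
}.

Definition induced_rep (A : preTopStarAlgType R)
    (Phi : star_hom A (adjointable E)) (K : induction) :
    representation A (ind_space K) :=
  rep_comp (ind_op K) Phi.

End Induced.

Section InnerTensor.
Variables (R : realType) (B C : locallyCstarType R).
Variables (E : hilbertModuleType B) (F : hilbertModuleType C).
Variable Phi : star_hom B (adjointable F).

Definition itp_form : tensor E F -> tensor E F -> C :=
  tens_form (fun x y x' y' => hminner y (Phi (hminner x x') y')).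

Lemma itp_form_balanced :
  form_balanced (fun (x : E) (y : F) (x' : E) (y' : F) =>
    hminner y (Phi (hminner x x') y')).
Proof.
split=> x y; split=> [z z' t|z t t'|k z t].
- by rewrite hminnerDr star_homD hminnerDr.
- by rewrite adj_funD hminnerDr.
- by rewrite hminnerZr star_homZ adj_funZ.
- by rewrite hminnerDl star_homD hminnerDr.
- by rewrite hminnerDl.
- by rewrite hminnerZl star_homZ hminnerZr hminnerZl.
Qed.

Lemma itp_form_tens (x x' : E) (y y' : F) :
  itp_form (x \ox y) (x' \ox y') = hminner y (Phi (hminner x x') y').
Proof. exact: tens_form_tens itp_form_balanced. Qed.

(* The inner tensor product, in the same form as induction: a Hilbert C-module
   completion of E (x)_alg F modulo the vectors of zero length, together with
   the *-morphism L_B(E) -> L_C(itp_space) induced by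
   x (x) y |-> T x (x) y. *)
Record inner_tensor := InnerTensor {
  itp_space : hilbertModuleType C ;
  itp_map : {linear tensor E F -> itp_space} ;
  itp_ract : forall x y c,
    itp_map (x \ox ract y c) = ract (itp_map (x \ox y)) c ;
  itp_inner : forall u v, hminner (itp_map u) (itp_map v) = itp_form u v ;
  itp_dense : dense (range itp_map) ;
  itp_op : star_hom (adjointable E) (adjointable itp_space) ;
  itp_opE : forall T x y, itp_op T (itp_map (x \ox y)) = itp_map (T x \ox y)
}.

End InnerTensor.

(* Main.v *)
(* For x in E, y in F, h in H, the vectors (x (x) y) (x) h of GH and
   x (x) (y (x) h) of EFH have the same Gram matrix, both inner products being
   <h, phi(<y, Phi2(<x, x'>) y'>) h'>, and each family has a dense span. Hence
   there is a unitary GH -> EFH matching the two families. It intertwines the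
   actions of A because both act by x |-> Phi1(a) x on the first factor.
   For the density in GH one needs that z |-> z (x) h is continuous on the inner
   tensor product of E and F: the square of the norm of z (x) h is
   <h, phi(<z, z>) h>, and phi is continuous at 0. *)
Require Import Defs.
From HB Require Import structures.
From mathcomp Require Import all_boot all_order all_algebra.
From mathcomp Require Import generic_quotient complex ring.
From mathcomp Require Import all_classical all_reals all_analysis.

Set Implicit Arguments.
Unset Strict Implicit.
Unset Printing Implicit Defensive.

Import Order.TTheory GRing.Theory Num.Theory.
Import numFieldNormedType.Exports.

Local Open Scope classical_set_scope.
Local Open Scope quotient_scope.
Local Open Scope ring_scope.
Local Open Scope complex_scope.

(** * Inner products, norms and polarization *)

Section HilbertSpace.
Variables (R : realType) (H : hilbertType R).
Implicit Types x y z : H.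

Lemma hinner0r x : hinner x 0 = 0.
Proof. by apply: (addrI (hinner x 0)); rewrite -hinnerDr !addr0. Qed.

Lemma hinner0l x : hinner 0 x = 0.
Proof. by rewrite -hinner_conj hinner0r conjc0. Qed.

Lemma hinner_sumr (J : Type) (s : seq J) (f : J -> H) x :
  hinner x (\sum_(j <- s) f j) = \sum_(j <- s) hinner x (f j).
Proof. exact: (big_morph (hinner x) (hinnerDr x) (hinner0r x)). Qed.

Lemma hinner_suml (J : Type) (s : seq J) (f : J -> H) x :
  hinner (\sum_(j <- s) f j) x = \sum_(j <- s) hinner (f j) x.
Proof.
by apply: (big_morph (hinner^~ x)) => [y z|]; rewrite ?hinnerDl// hinner0l.
Qed.

Lemma hinner_polarD x y :
  hinner x y + hinner y x = `|x + y| ^+ 2 - `|x| ^+ 2 - `|y| ^+ 2.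
Proof. by rewrite -!hinner_norm hinnerDr !hinnerDl; ring. Qed.

(** Cauchy-Schwarz for a real inner product: symmetry turns [2 <x, y>] into
    [|x + y|^2 - |x|^2 - |y|^2], which the triangle inequality bounds. *)
Lemma hinner_real_le x y : hinner x y = hinner y x ->
  hinner x y <= `|x| * `|y|.
Proof.
move=> xy; rewrite -(ler_pMn2r (n := 2))// mulr2n {2}xy hinner_polarD.
have : `|x + y| ^+ 2 <= (`|x| + `|y|) ^+ 2.
  by rewrite ler_sqr ?nnegrE ?addr_ge0// ler_normD.
rewrite -subr_ge0 => h; rewrite -subr_ge0; apply: le_trans h _.
by rewrite le_eqVlt; apply/orP; left; apply/eqP; ring.
Qed.

End HilbertSpace.

Lemma linear_isometry_hinner (R : realType) (H K : hilbertType R)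
    (U : {linear H -> K}) :
  (forall x, `|U x| = `|x|) -> forall x y, hinner (U x) (U y) = hinner x y.
Proof.
move=> Un.
have sym x y :
    hinner (U x) (U y) + hinner (U y) (U x) = hinner x y + hinner y x.
  by rewrite !hinner_polarD -linearD !Un.
move=> x y.
(* Polarization: the pair (x, i y) determines <x, y> - <y, x>. *)
have := sym x ('i%R *: y); rewrite linearZ !hinnerZr !hinnerZl conjCi.
rewrite !mulNr -!mulrBr => /(mulfI (@neq0Ci _)) d.
have {}sym := sym x y.
(* Twice the inner product is the sum of its symmetric part, given by [sym], and its antisymmetric
   part, given by [d]. *)
apply: (@mulIf _ 2); first by rewrite pnatr_eq0.
rewrite !mulr_natr !mulr2n.
have e (u v : R[i]) : u + u = (u + v) + (u - v) by ring.
by rewrite (e _ (hinner (U y) (U x))) sym d -e.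
Qed.

(** * Density and approximation by linear combinations *)

Lemma dense_nbhs (T : topologicalType) (S U : set T) (x : T) :
  dense S -> nbhs x U -> S `&` U !=set0.
Proof.
move=> dS xU; have [z [Uz Sz]] : U° `&` S !=set0.
  apply: dS; last exact: open_interior.
  by exists x; exact: nbhs_singleton (nbhs_interior xU).
by exists z; split=> //; exact: interior_subset Uz.
Qed.

Section LinearCombination.
Variables (K : nzRingType) (V : lmodType K) (I : Type) (a : I -> V).

(** The combination [s] is formal data, so that it can be evaluated on two families in different
    spaces. *)
Definition lincomb (s : seq (K * I)) := \sum_(p <- s) p.1 *: a p.2.

Lemma lincomb_cat s t : lincomb (s ++ t) = lincomb s + lincomb t.
Proof. exact: big_cat. Qed.

Lemma lincombZ k s : lincomb [seq (k * p.1, p.2) | p <- s] = k *: lincomb s.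
Proof.
by rewrite /lincomb big_map scaler_sumr; apply: eq_bigr => p _; rewrite scalerA.
Qed.

End LinearCombination.

Section Density.
Variables (K : numFieldType) (V : normedModType K) (D : set V).

Definition approximable (x : V) :=
  forall e : K, 0 < e -> exists2 z, D z & `|x - z| < e.

Lemma dense_approximable x : dense D -> approximable x.
Proof.
move=> dD e e0; have [z [Dz xz]] := dense_nbhs dD (nbhsx_ballx x e e0).
by exists z => //; move: xz; rewrite -ball_normE.
Qed.

Lemma approximable_dense : (forall x, approximable x) -> dense D.
Proof.
move=> ap O [x Ox] oO.
have /nbhs_ballP[e /= e0 eO] : nbhs x O by exact: open_nbhs_nbhs.
have [z Dz xz] := ap x e e0; exists z; split=> //.
by apply: eO; rewrite -ball_normE.
Qed.

(** Idempotence of closure; it allows approximation in two stages, first by images of algebraic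
    tensors and then by combinations of generators. *)
Lemma approximable_closed x :
  (forall e : K, 0 < e -> exists2 z, approximable z & `|x - z| < e) ->
  approximable x.
Proof.
move=> ap e e0; have e20 : 0 < e / 2 by rewrite divr_gt0.
have [z /(_ _ e20)[w Dw zw] xz] := ap _ e20.
exists w => //; rewrite [e]splitr -(subrKA z).
by rewrite (le_lt_trans (ler_normD _ _))// ltrD.
Qed.

End Density.

Lemma approximableD (K : numFieldType) (V : normedModType K) (I : Type)
    (a : I -> V) x y :
  approximable (range (lincomb a)) x -> approximable (range (lincomb a)) y ->
  approximable (range (lincomb a)) (x + y).
Proof.
move=> ax ay e e0; have e20 : 0 < e / 2 by rewrite divr_gt0.
have [_ [s _ <-] xs] := ax _ e20; have [_ [t _ <-] yt] := ay _ e20.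
exists (lincomb a (s ++ t)); first by exists (s ++ t).
rewrite lincomb_cat opprD addrACA [e]splitr.
by rewrite (le_lt_trans (ler_normD _ _))// ltrD.
Qed.

Lemma approximable_sum (K : numFieldType) (V : normedModType K) (I J : Type)
    (a : I -> V) (r : seq J) (f : J -> V) :
  (forall j, approximable (range (lincomb a)) (f j)) ->
  approximable (range (lincomb a)) (\sum_(j <- r) f j).
Proof.
move=> af; elim/big_ind : _ => // [e e0|]; last exact: approximableD.
exists 0; last by rewrite subrr normr0.
by exists [::] => //; exact: big_nil.
Qed.

Lemma approximable_gen (K : numFieldType) (V : normedModType K) (I : Type)
    (a : I -> V) i : approximable (range (lincomb a)) (a i).
Proof.
move=> e e0; exists (a i); last by rewrite subrr normr0.
by exists [:: (1, i)] => //; rewrite /lincomb big_seq1 scale1r.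
Qed.

Lemma dense_bounded_linear_eq (K : numFieldType) (V W : normedModType K)
    (I : Type) (a : I -> V) (f g : {linear V -> W}) (M N : K) :
  0 <= M -> 0 <= N ->
  (forall x, `|f x| <= M * `|x|) -> (forall x, `|g x| <= N * `|x|) ->
  dense (range (lincomb a)) -> (forall i, f (a i) = g (a i)) -> f =1 g.
Proof.
move=> M0 N0 fM gN da fg x; apply/eqP; rewrite -subr_eq0 -normr_le0.
have fgs s : f (lincomb a s) = g (lincomb a s).
  by rewrite /lincomb !linear_sum; apply: eq_bigr => p _; rewrite !linearZZ fg.
apply/ler_addgt0Pr => e e0; rewrite add0r.
(* The added 1 keeps the divisor positive when both bounds vanish. *)
have MN : 0 < M + N + 1 by rewrite ltr_wpDl// addr_ge0.
have [_ [s _ <-] xs] := dense_approximable x da (divr_gt0 e0 MN).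
have -> : f x - g x = f (x - lincomb a s) - g (x - lincomb a s).
  by rewrite (linearB f) (linearB g) fgs opprB addrA subrK.
apply: le_trans (ler_normB _ _) _; apply: le_trans (lerD (fM _) (gN _)) _.
rewrite -mulrDl; apply: (@le_trans _ _ ((M + N + 1) * `|x - lincomb a s|)).
  by rewrite ler_wpM2r// lerDl.
by rewrite mulrC -ler_pdivlMr// ltW.
Qed.

(** * The unitary determined by two families with equal Gram matrices *)

Section GramIsometry.
Variables (R : realType) (H K : hilbertType R) (I : Type).
Variables (a : I -> H) (b : I -> K).
Hypothesis gram : forall i j, hinner (a i) (a j) = hinner (b i) (b j).

Lemma lincomb_norm s : `|lincomb a s| = `|lincomb b s|.
Proof.
apply/eqP; rewrite -(eqrXn2 (n := 2))// -!hinner_norm; apply/eqP.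
rewrite /lincomb !hinner_suml; apply: eq_bigr => p _.
rewrite !hinner_sumr; apply: eq_bigr => r _.
by rewrite !hinnerZl !hinnerZr gram.
Qed.

Lemma lincomb_dist s t :
  `|lincomb a s - lincomb a t| = `|lincomb b s - lincomb b t|.
Proof.
have := lincomb_norm (s ++ [seq (-1 * p.1, p.2) | p <- t]).
by rewrite !lincomb_cat !lincombZ !scaleN1r.
Qed.

(* The graph of the isometry: the closure of the pairs of corresponding linear
   combinations. *)
Definition gram_rel x y := forall e : R[i], 0 < e ->
  exists s, `|x - lincomb a s| < e /\ `|y - lincomb b s| < e.

Lemma gram_rel_gen i : gram_rel (a i) (b i).
Proof.
move=> e e0; exists [:: (1, i)].
by rewrite /lincomb !big_seq1 !scale1r !subrr !normr0.
Qed.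

Lemma gram_rel_linear k x x' y y' :
  gram_rel x y -> gram_rel x' y' -> gram_rel (k *: x + x') (k *: y + y').
Proof.
move=> xy xy' e e0.
have k0 : 0 < `|k| + 1 by rewrite ltr_wpDl.
(* A common tolerance [d]: the error scaled by [k] and the unscaled one add up to less than [e]. *)
have : exists d, 0 < d /\ e = `|k| * d + d.
  exists (e / (`|k| + 1)); split; first by rewrite divr_gt0.
  by rewrite -[X in _ + X]mul1r -mulrDl mulrC divfK ?lt0r_neq0.
move=> [d [d0 ed]].
have [s [xs ys]] := xy _ d0; have [t [xt yt]] := xy' _ d0.
have lt_e (V : normedModType R[i]) (u u' v v' : V) :
    `|u - v| < d -> `|u' - v'| < d ->
    `|k *: u + u' - (k *: v + v')| < e.
  move=> uv uv'; rewrite opprD addrACA -scalerBr.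
  apply: le_lt_trans (ler_normD _ _) _; rewrite normrZ.
  by rewrite ed ler_ltD// ler_wpM2l// ltW.
exists ([seq (k * p.1, p.2) | p <- s] ++ t); rewrite !lincomb_cat !lincombZ.
by split; exact: lt_e.
Qed.

Lemma gram_rel_norm x y : gram_rel x y -> `|x| = `|y|.
Proof.
have le (V W : normedModType R[i]) (u v : V) (u' v' : W) (e : R[i]) :
    `|v| = `|v'| -> `|u - v| < e / 2 -> `|u' - v'| < e / 2 -> `|u| <= `|u'| + e.
  move=> vv' uv uv'; rewrite -[u](subrK v) (le_trans (ler_normD _ _))// vv'.
  have vu : `|v'| <= e / 2 + `|u'|.
    by rewrite -[v'](subrK u') (le_trans (ler_normD _ _))// lerD2r distrC ltW.
  by rewrite (le_trans (lerD (ltW uv) vu))// addrA -splitr addrC.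
move=> xy; apply/eqP; rewrite eq_le.
apply/andP; split; apply/ler_addgt0Pr => e e0;
  have [s [xs ys]] := xy _ (divr_gt0 e0 (ltr0Sn _ 1)).
  exact: le (lincomb_norm s) xs ys.
exact: le (esym (lincomb_norm s)) ys xs.
Qed.

(** By linearity [0] is related to [y' - y], which has norm 0 because related vectors have equal
    norms. *)
Lemma gram_rel_fun x y y' : gram_rel x y -> gram_rel x y' -> y = y'.
Proof.
move=> xy xy'; have := gram_rel_norm (gram_rel_linear (-1) xy xy').
rewrite !scaleN1r addNr normr0 => /esym/eqP; rewrite normr_eq0 addrC subr_eq0.
by move=> /eqP.
Qed.

Lemma gram_rel_ex x : dense (range (lincomb a)) -> exists y, gram_rel x y.
Proof.
move=> da.
(* The image of the neighbourhoods of x under the relation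
   lincomb a s |-> lincomb b s; it is Cauchy since this relation is isometric. *)
pose F : set_system K :=
  [set S | nbhs x [set z | forall s, lincomb a s = z -> S (lincomb b s)]].
have FF : ProperFilter F.
  apply: Build_ProperFilter.
    (* Density puts a combination of [a] in every neighbourhood of [x], which keeps the empty set
       out of [F]. *)
    by move=> /(dense_nbhs da)[_ [[s _ <-] /(_ s erefl)]].
  split=> [|S T FS FT|S T ST FS].
  - by apply: (@filterE _ (nbhs x)) => z s _.
  - apply: (@filterS2 _ (nbhs x)) FS FT => z Sz Tz s sz.
    by split; [exact: Sz|exact: Tz].
  - by apply: (@filterS _ (nbhs x)) FS => z Sz s sz; apply: ST; exact: Sz.
have /cauchy_cvg/cvg_ex[y Fy] : cauchy F.
  apply: cauchy_exP => e e0; have e20 : 0 < e / 2 by rewrite divr_gt0.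
  have [_ [s _ <-] xs] := dense_approximable x da e20.
  exists (lincomb b s).
  apply: (@filterS _ (nbhs x)) (nbhsx_ballx x _ e20) => z + t tz; rewrite -{}tz.
  rewrite -!ball_normE /= => xt; rewrite -lincomb_dist.
  rewrite -(subrKA x) [e]splitr (le_lt_trans (ler_normD _ _))// ltrD//.
  by rewrite distrC.
exists y => e e0.
(* Combinations of [a] close enough to [x] have images close to [y]; density supplies one that meets
   both requirements. *)
have Fe : F (ball y e) by exact: Fy (nbhsx_ballx y e e0).
have [_ [[s _ <-] [xs ys]]] := dense_nbhs da (filterI (nbhsx_ballx x e e0) Fe).
exists s; split; first by move: xs; rewrite -ball_normE.
by have := ys s erefl; rewrite -ball_normE.
Qed.

End GramIsometry.

Lemma gram_relC (R : realType) (H K : hilbertType R) (I : Type)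
    (a : I -> H) (b : I -> K) x y : gram_rel a b x y -> gram_rel b a y x.
Proof. by move=> xy e /xy[s [xs ys]]; exists s. Qed.

(** [gram_rel] is total, single-valued and linear, hence the graph of a linear isometry. Exchanging
    the two families shows that every [y] is attained. *)
Lemma gram_unitary (R : realType) (H K : hilbertType R) (I : Type)
    (a : I -> H) (b : I -> K) :
  (forall i j, hinner (a i) (a j) = hinner (b i) (b j)) ->
  dense (range (lincomb a)) -> dense (range (lincomb b)) ->
  exists U : {linear H -> K},
    [/\ forall x y, hinner (U x) (U y) = hinner x y,
        forall y, exists x, U x = y &
        forall i, U (a i) = b i].
Proof.
move=> gram da db; pose U x := projT1 (cid (gram_rel_ex gram x da)).
have UP x : gram_rel a b x (U x) := projT2 (cid (gram_rel_ex gram x da)).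
have Ulin : linear U.
  by move=> k x y; apply: (gram_rel_fun gram (UP _)); exact: gram_rel_linear.
pose UL := HB.pack_for {linear H -> K} U (GRing.isLinear.Build _ _ _ _ U Ulin).
exists UL; split.
- by apply: linear_isometry_hinner => x; apply/esym/(gram_rel_norm gram)/UP.
- move=> y.
  have [x /gram_relC xy] := gram_rel_ex (fun i j => esym (gram i j)) y db.
  by exists x; exact: (gram_rel_fun gram (UP x) xy).
- by move=> i; exact: (gram_rel_fun gram (UP _) (gram_rel_gen _ _ _)).
Qed.

(** * Expansion of algebraic tensors into pure tensors *)

Section TensorSum.
Variables (K : comNzRingType) (V W : lmodType K).

Lemma tens_piE s : \pi_(tensor V W) s = \sum_(p <- s) p.1 \ox p.2.
Proof.
elim: s => [|[x y] s IH]; first by rewrite big_nil.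
by rewrite big_cons -IH -[RHS]/(tadd _ _) tadd_pi.
Qed.

Lemma tens0l (y : W) : (0 : V) \ox y = 0.
Proof. by apply: (addrI ((0 : V) \ox y)); rewrite -tensDl !addr0. Qed.

Lemma tens0r (x : V) : x \ox (0 : W) = 0.
Proof. by apply: (addrI (x \ox (0 : W))); rewrite -tensDr !addr0. Qed.

Lemma tens_suml (J : Type) (s : seq J) (f : J -> V) (y : W) :
  (\sum_(j <- s) f j) \ox y = \sum_(j <- s) f j \ox y.
Proof.
by apply: (big_morph (fun x => x \ox y)) => [u v|]; rewrite ?tensDl ?tens0l.
Qed.

Lemma tens_sumr (J : Type) (s : seq J) (f : J -> W) (x : V) :
  x \ox (\sum_(j <- s) f j) = \sum_(j <- s) x \ox f j.
Proof. by apply: (big_morph (tens x)) => [u v|]; rewrite ?tensDr ?tens0r. Qed.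

Lemma tensBl (x x' : V) (y : W) : (x - x') \ox y = x \ox y - x' \ox y.
Proof. by rewrite tensDl -scaleN1r tensZl scaleN1r. Qed.

Lemma tensBr (x : V) (y y' : W) : x \ox (y - y') = x \ox y - x \ox y'.
Proof. by rewrite tensDr -scaleN1r tensZr scaleN1r. Qed.

End TensorSum.

(** * Operator distance and the topology of bounded operators *)

Section OperatorTopology.
Variables (R : realType) (H : hilbertType R).
Implicit Types S T : bounded_op H.

Lemma bop_bound T :
  exists2 M : R[i], 0 <= M & forall x, `|T x| <= M * `|x|.
Proof.
have [M TM] := bop_bounded T; exists `|M| => // x.
(* [M] is any complex number, but [M * |x|] dominates a norm, so it is nonnegative and equals
   [|M| * |x|]. *)
have Mx := le_trans (normr_ge0 _) (TM x).
by rewrite -[`|x|]normr_id -normrM (ger0_norm Mx).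
Qed.

Lemma Re_le (z w : R[i]) : z <= w -> complex.Re z <= complex.Re w.
Proof. by rewrite lecE => /andP[]. Qed.

(** The real [sup] in [op_dist] takes a default value on unbounded sets, so it bounds anything only
    once this is known. *)
Lemma op_dist_ub S T : has_ubound
  [set complex.Re `|S x - T x| | x in [set x | `|x| <= 1]].
Proof.
have [M M0 SM] := bop_bound S; have [N N0 TN] := bop_bound T.
exists (complex.Re (M + N)) => _ [x /= x1 <-]; apply: Re_le.
rewrite (le_trans (ler_normB _ _))// lerD//.
  by rewrite (le_trans (SM x))// ler_piMr.
by rewrite (le_trans (TN x))// ler_piMr.
Qed.

Lemma op_dist_le S T x : `|S x - T x| <= (op_dist S T)%:C * `|x|.
Proof.
have [->|x0] := eqVneq x 0.
  by rewrite (linear0 S) (linear0 T) subrr !normr0 mulr0.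
have nx0 : 0 < `|x| by rewrite normr_gt0.
have -> : S x - T x = `|x| *: (S (`|x|^-1 *: x) - T (`|x|^-1 *: x)).
  rewrite (linearZZ S) (linearZZ T) -scalerBr scalerA.
  by rewrite divff ?gt_eqF// scale1r.
rewrite normrZ normr_id mulrC ler_pM2r//.
rewrite -[leLHS]RRe_real ?normr_real// lecR.
apply: ub_le_sup (op_dist_ub S T) _ _.
by exists (`|x|^-1 *: x) => //=; rewrite normrZ normfV normr_id mulVf ?gt_eqF.
Qed.

Lemma op_dist_xx T : op_dist T T = 0.
Proof.
rewrite /op_dist -[RHS]sup1; congr sup.
apply/seteqP; split => [_ [x _ <-]|_ ->].
  by rewrite subrr normr0.
by exists 0; rewrite /= ?subrr normr0.
Qed.

Lemma nbhs_op_dist T (e : R) : 0 < e -> nbhs T [set S | op_dist S T < e].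
Proof.
move=> e0; apply: open_nbhs_nbhs; split; last by rewrite /= op_dist_xx.
exists [set [set S | op_dist S T < e]]; last by rewrite bigcup_set1.
move=> _ ->; exists (finmap.fset1 (T, e)); first by move=> i _; rewrite inE.
apply/seteqP; split => [S Se | S Se i /=]; last first.
  by rewrite finmap.in_fset1 => /eqP ->.
by apply: (Se (T, e)); rewrite /= finmap.in_fset1.
Qed.

End OperatorTopology.

(** Both topologies are tested on the seminorms of [B]: convergence in [E] controls the square
    roots, and squaring controls [<x, x>] itself. *)
Lemma hminner_cvg0 (R : realType) (B : locallyCstarType R)
    (E : hilbertModuleType B) :
  (fun x : E => hminner x x) @ nbhs (0 : E) --> (0 : B).
Proof.
apply/lCstar_seminorm_cvg => p Sp.
have p0 := (hm_seminorm_cvg (nbhs (0 : E)) (nbhs_filter _)).1 cvg_id p Sp.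
rewrite -[p @ _]/((fun x : E => p (hminner x x)) @ nbhs (0 : E)).
have -> : (fun x : E => p (hminner x x)) = (fun x =>
    Num.sqrt (p (hminner x x)) * Num.sqrt (p (hminner x x))).
  by apply/funext => x; rewrite -expr2 sqr_sqrtr// (Cstar_ge0 Sp.1).
by rewrite -[X in _ --> X](mulr0 (0 : R)); exact: cvgM.
Qed.

(** * Estimates and approximation in the induced space *)

Section Induction.
Variables (R : realType) (B : locallyCstarType R) (E : hilbertModuleType B).
Variables (H : hilbertType R) (phi : representation B H).
Variable K : induction E phi.

(** The inner product of [h] with [phi(<x, x>) h] is real since [<x, x>] is self-adjoint, so the
    real case of Cauchy-Schwarz applies. *)
Lemma ind_map_norm_le x h :
  `|ind_map K (x \ox h)| ^+ 2 <= `|h| * `|phi (hminner x x) h|.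
Proof.
rewrite -hinner_norm ind_inner ind_form_tens; apply: hinner_real_le.
by rewrite -[in RHS](hminner_star x x) rep_star.
Qed.

Lemma ind_map_near0 (h : H) (e : R[i]) : 0 < e ->
  \forall x \near (0 : E), `|ind_map K (x \ox h)| < e.
Proof.
move=> e0; have /complex_realP[e' e'E] := gtr0_real e0.
have {}e'0 : 0 < e' by rewrite -ltcR -e'E.
have /complex_realP[r rE] := normr_real h.
have r0 : 0 <= r by rewrite -lecR -rE normr_ge0.
(* Chosen so that [d * r^2 < e'^2], including the case [r = 0]; here [r] and [e'] are the real
   values of [|h|] and [e]. *)
pose d := e' ^+ 2 / (r ^+ 2 + 1).
have r1 : 0 < r ^+ 2 + 1 by rewrite ltr_wpDl// sqr_ge0.
have d0 : 0 < d by rewrite divr_gt0// exprn_gt0.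
have phi0 : phi 0 h = 0.
  by apply: (addrI (phi 0 h)); rewrite -repD !addr0.
have : \forall b \near (0 : B), op_dist (phi b) (phi 0) < d.
  exact: (@rep_continuous _ _ _ phi 0 _ (nbhs_op_dist (phi 0) d0)).
move=> /(@hminner_cvg0 _ _ E); apply: (@filterS _ (nbhs (0 : E))) => x /= xd.
rewrite -(ltr_sqr (x := `|_|)) ?nnegrE ?normr_ge0 ?(ltW e0)//.
apply: le_lt_trans (ind_map_norm_le _ _) _.
have := op_dist_le (phi (hminner x x)) (phi 0) h.
rewrite phi0 subr0 => /(ler_wpM2l (normr_ge0 h)); move/le_lt_trans; apply.
rewrite mulrCA -expr2 rE e'E -!rmorphXn -rmorphM /= ltcR.
apply: (@le_lt_trans _ _ (d * r ^+ 2)).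
  by rewrite ler_wpM2r ?sqr_ge0// ltW.
by rewrite /d mulrAC ltr_pdivrMr// ltr_pM2l ?exprn_gt0// ltrDl.
Qed.

Lemma ind_map_approx_l (S : set E) x h (e : R[i]) : dense S -> 0 < e ->
  exists2 z, S z & `|ind_map K (x \ox h) - ind_map K (z \ox h)| < e.
Proof.
move=> dS e0; have := ind_map_near0 h e0; rewrite -(subrr x).
(* Continuity of subtraction at [(x, x)] carries the estimate at 0 over to [x]. *)
move=> /(@sub_continuous E (x, x))[[P Q] /= [Px Qx] PQ].
have [z [Sz Qz]] := dense_nbhs dS Qx; exists z => //.
rewrite -linearB -tensBl; exact: (PQ (x, z) (conj (nbhs_singleton Px) Qz)).
Qed.

Lemma ind_map_approx_r (S : set H) x h (e : R[i]) : dense S -> 0 < e ->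
  exists2 k, S k & `|ind_map K (x \ox h) - ind_map K (x \ox k)| < e.
Proof.
move=> dS e0; have [M M0 pM] := bop_bound (phi (hminner x x)).
have d0 : 0 < e / (M + 1) by rewrite divr_gt0// ltr_wpDl.
have [k Sk hk] := dense_approximable h dS d0; exists k => //.
rewrite -linearB -tensBr -(ltr_sqr (x := `|_|)) ?nnegrE ?normr_ge0 ?(ltW e0)//.
apply: le_lt_trans (ind_map_norm_le _ _) _.
apply: le_lt_trans (ler_wpM2l (normr_ge0 _) (pM _)) _.
have M1 : 0 < M + 1 by rewrite ltr_wpDl.
have : `|h - k| * (M + 1) < e by rewrite -ltr_pdivlMr.
(* This bounds [M |h - k|^2] by the square of [(M + 1) |h - k|], so no square root of [M] is
   needed. *)
have MM : M <= (M + 1) ^+ 2.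
  rewrite expr2 mulrDl mul1r (le_trans (y := M + 1))// ?lerDl//.
  by rewrite lerDr mulr_ge0// ltW.
rewrite -(ltr_sqr (x := _ * _)) ?nnegrE ?mulr_ge0 ?(ltW e0) ?(ltW M1)//.
apply: le_lt_trans; rewrite exprMn [leRHS]mulrC mulrCA -expr2.
by rewrite ler_wpM2r// sqr_ge0.
Qed.

(** The image of the algebraic tensor product is dense and consists of finite sums of images of pure
    tensors. *)
Lemma ind_total (I : Type) (a : I -> ind_space K) :
  (forall x h, approximable (range (lincomb a)) (ind_map K (x \ox h))) ->
  dense (range (lincomb a)).
Proof.
move=> aK; apply: approximable_dense => y; apply: approximable_closed => e e0.
have [_ [u _ <-] yu] := dense_approximable y (@ind_dense _ _ _ _ _ K) e0.
exists (ind_map K u) => //; elim/tens_ind: u {yu} => s.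
by rewrite tens_piE linear_sum; exact: approximable_sum.
Qed.

End Induction.

Theorem theorem3p6 (R : realType) (A B C : locallyCstarType R)
  (E : hilbertModuleType B) (F : hilbertModuleType C)
  (Phi1 : star_hom A (adjointable E)) (Phi2 : star_hom B (adjointable F))
  (ndPhi1 : nondegenerate_hom Phi1) (ndPhi2 : nondegenerate_hom Phi2)
  (G : inner_tensor E Phi2)
  (H : hilbertType R) (phi : representation C H)
  (ndphi : nondegenerate_rep phi)
  (GH : induction (itp_space G) phi)
  (FH : induction F phi)
  (EFH : induction E (induced_rep Phi2 FH)) :
  unitarily_equivalent
    (induced_rep (star_comp (itp_op G) Phi1) GH)
    (induced_rep Phi1 EFH).
Proof.
pose a (p : E * F * H) := ind_map GH (itp_map G (p.1.1 \ox p.1.2) \ox p.2).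
pose b (p : E * F * H) := ind_map EFH (p.1.1 \ox ind_map FH (p.1.2 \ox p.2)).
have gram p q : hinner (a p) (a q) = hinner (b p) (b q).
  rewrite !ind_inner !ind_form_tens itp_inner itp_form_tens /=.
  by rewrite ind_opE ind_inner ind_form_tens.
have da : dense (range (lincomb a)).
  (* With [h] fixed, [g] is approximated by the image of an algebraic tensor of [E] and [F], which
     expands into members of [a]. *)
  apply: ind_total => g h; apply: approximable_closed => e e0.
  have [_ [u _ <-] gu] := ind_map_approx_l GH g h (@itp_dense _ _ _ _ _ _ G) e0.
  exists (ind_map GH (itp_map G u \ox h)) => //; elim/tens_ind: u {gu} => s.
  rewrite tens_piE linear_sum tens_suml linear_sum.
  by apply: approximable_sum => p; exact: (approximable_gen a (p, h)).
have db : dense (range (lincomb b)).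
  (* Here [x] is fixed, and the approximation takes place in the second factor, the space of
     [FH]. *)
  apply: ind_total => x k; apply: approximable_closed => e e0.
  have [_ [v _ <-] kv] := ind_map_approx_r EFH x k (@ind_dense _ _ _ _ _ FH) e0.
  exists (ind_map EFH (x \ox ind_map FH v)) => //; elim/tens_ind: v {kv} => s.
  rewrite tens_piE linear_sum tens_sumr linear_sum.
  by apply: approximable_sum => p; exact: (approximable_gen b (x, p.1, p.2)).
have [U [Uinner Usurj Uab]] := gram_unitary gram da db.
have Unorm y : `|U y| = `|y|.
  by apply/eqP; rewrite -(eqrXn2 (n := 2))// -!hinner_norm Uinner.
exists U; split=> // c.
set S := induced_rep _ GH c; set T := induced_rep _ EFH c.
have [M M0 SM] := bop_bound S; have [N N0 TN] := bop_bound T.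
(* As [U] preserves norms, both composites inherit the bounds of [S] and [T], so comparing them on
   the family [a] suffices. *)
apply: (dense_bounded_linear_eq (a := a) (f := U \o S) (g := T \o U) M0 N0).
- by move=> x /=; rewrite Unorm.
- by move=> x /=; rewrite -[in leRHS]Unorm.
- exact: da.
move=> p; rewrite /= Uab /= !ind_opE itp_opE.
(* Acting by [c] on a generator yields the generator whose first entry is moved by [Phi1 c]. *)
exact: (Uab (Phi1 c p.1.1, p.1.2, p.2)).
Qed.
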